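(* Let $N\ge 2$ and $M\ge 1$ be integers, let $\xi_1,\dots,\xi_M\ge 0$ be real numbers, and let $u_0\in\mathbf{H}^{N-1}$ be a fixed point. Let $u_0,u_1,\dots,u_M$ be the Markov chain on $\mathbf{H}^{N-1}$ in which, for each $i=1,\dots,M$, given $u_0,\dots,u_{i-1}$, the point $u_i$ is uniformly distributed on $\Sigma(u_{i-1},\xi_i)$. Then $$\mathbb{E}\left[\langle u_M,u_0\rangle_{\mathbf{H}}\right]=\prod_{i=1}^M\cosh\xi_i ,$$ and the standard deviation $\sigma$ of the random variable $\langle u_M,u_0\rangle_{\mathbf{H}}$ satisfies $$\sigma^2=\sum_{S\subset\{1,\ldots,M\},\ \#S\ge2}\left[\left(\frac{N}{N-1}\right)^{\#S-1}-1\right]\prod_{i\in S}\sinh^2\xi_i$$ and $$\sigma\le\sqrt{\left(\frac{N}{N-1}\right)^{M-1}-1}\ \prod_{i=1}^M\cosh\xi_i .$$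
   Context: On $\mathbb{R}^N$ let $\langle x,y\rangle_{\mathbf{H}}:=x_1y_1-x_2y_2-\cdots-x_Ny_N$ be the Minkowski inner product. The $(N-1)$-dimensional hyperbolic space is modeled as $$\mathbf{H}^{N-1}:=\{x\in\mathbb{R}^N:\langle x,x\rangle_{\mathbf{H}}=1,\ x_1>0\}.$$ The distance $\xi\ge0$ between $u,v\in\mathbf{H}^{N-1}$ is defined by $\cosh\xi=\langle u,v\rangle_{\mathbf{H}}$. For $u\in\mathbf{H}^{N-1}$ and $\xi\ge0$, $$\Sigma(u,\xi):=\{\cosh\xi\cdot u+\sinh\xi\cdot w: w\in S^{N-2}_{u^\perp}\},$$ where $S^{N-2}_{u^\perp}=\{w\in\mathbb{R}^N:\langle w,u\rangle_{\mathbf{H}}=0,\ \langle w,w\rangle_{\mathbf{H}}=-1\}$ is the unit sphere in the hyperplane $\langle\cdot,\cdot\rangle_{\mathbf{H}}$-perpendicular to $u$, on which $-\langle\cdot,\cdot\rangle_{\mathbf{H}}$ is a Euclidean inner product. ''Uniformly distributed on $\Sigma(u,\xi)$'' means distributed as $\cosh\xi\cdot u+\sinh\xi\cdot w$ with $w$ distributed according to the rotation-invariant probability measure on this Euclidean unit sphere $S^{N-2}_{u^\perp}$ (for $N=2$, the uniform measure on two points). $\#S$ denotes the cardinality of $S$. *)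

(* Defs.v *)
From HB Require Import structures.
From mathcomp Require Import all_boot all_order all_algebra.
From mathcomp Require Import all_classical all_reals all_analysis.

Set Implicit Arguments.
Unset Strict Implicit.
Unset Printing Implicit Defensive.

Import Order.TTheory GRing.Theory Num.Theory.
Import numFieldNormedType.Exports.

Local Open Scope classical_set_scope.
Local Open Scope ring_scope.

(* The sigma-algebra on R^N generated by the coordinates, i.e. its Borel
   sigma-algebra, set up as the library does for n.-tuple. *)
Section measurable_rV.
Variables (R : realType) (N : nat).

Let coord (i : 'I_N) (x : 'rV[R]_N) : measurableTypeR R := x ord0 i.

Let rV_set0 : g_sigma_preimage coord set0.
Proof. exact: sigma_algebra0. Qed.

Let rV_setC A : g_sigma_preimage coord A -> g_sigma_preimage coord (~` A).
Proof. exact: sigma_algebraC. Qed.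

Let rV_bigcup (F : (set 'rV[R]_N)^nat) :
  (forall i, g_sigma_preimage coord (F i)) ->
  g_sigma_preimage coord (\bigcup_i (F i)).
Proof. exact: sigma_algebra_bigcup. Qed.

HB.instance Definition _ := @isMeasurable.Build
  (measure_tuple_display R.-ocitv.-measurable.-sigma)%mdisp
  'rV[R]_N (g_sigma_preimage coord) rV_set0 rV_setC rV_bigcup.

End measurable_rV.

Definition cosh {R : realType} (t : R) : R := (expR t + expR (- t)) / 2.
Definition sinh {R : realType} (t : R) : R := (expR t - expR (- t)) / 2.

Section hyperbolic_space.
Variables (R : realType) (N : nat).
Implicit Types (x y u w : 'rV[R]_N).

(* The time coordinate x_1 is the one of index 0. *)
Definition minkowski_form x y : R :=
  \sum_(i < N) (if val i == 0%N then x ord0 i * y ord0 i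
                else - (x ord0 i * y ord0 i)).

Definition hyperbolic_space : set 'rV[R]_N :=
  [set x | minkowski_form x x = 1 /\ forall i : 'I_N, val i = 0%N -> 0 < x ord0 i].

Definition tangent_sphere u : set 'rV[R]_N :=
  [set w | minkowski_form w u = 0 /\ minkowski_form w w = -1].

(* For u in the hyperbolic space, R^N = <u> (+) u^perp, so the orthogonal
   transformations of the Euclidean hyperplane u^perp are exactly the
   restrictions of the linear Minkowski isometries g of R^N that fix u. Those of
   determinant -1 are included: for N = 2 the two points of the sphere are
   exchanged only by such a g. *)
Definition rotation_invariant u (nu : probability 'rV[R]_N R) : Prop :=
  nu (tangent_sphere u) = 1%E /\
  forall g : 'M[R]_N,
    (forall x y, minkowski_form (x *m g) (y *m g) = minkowski_form x y) ->
    u *m g = u ->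
    forall A, measurable A -> pushforward nu (fun w => w *m g) A = nu A.

Definition uniform_on_Sigma u (xi : R) (mu : set 'rV[R]_N -> \bar R) : Prop :=
  exists nu : probability 'rV[R]_N R, rotation_invariant u nu /\
    forall A, measurable A ->
      mu A = pushforward nu (fun w => cosh xi *: u + sinh xi *: w) A.

End hyperbolic_space.

Section hyperbolic_walk.
Context {d : measure_display} {Omega : measurableType d} {R : realType}.
Variables (P : probability Omega R) (N M : nat).
Variables (xi : 'I_M -> R) (u0 : 'rV[R]_N).
Variable u : 'I_M.+1 -> {RV P >-> 'rV[R]_N}.

Definition past (k : 'I_M.+1) : set (set Omega) :=
  <<s \bigcup_(j in [set j : 'I_M.+1 | (j <= k)%N])
        preimage_set_system setT (u j) measurable >>.

(* Steps are indexed by i : 'I_M; step i goes from u_i (widen_ord) to u_(i+1)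
   (lift ord0) and has length xi i. "Given u_0, ..., u_i, the point u_(i+1) is
   distributed as K(u_i)" means that K(u_i) is a regular conditional
   distribution of u_(i+1) given the sigma-algebra generated by u_0, ..., u_i.
   The values of K outside the hyperbolic space are irrelevant. *)
Definition hyperbolic_walk : Prop :=
  [/\ forall k omega, hyperbolic_space (u k omega),
      forall omega, u ord0 omega = u0 &
      forall i : 'I_M, exists K : R.-pker 'rV[R]_N ~> 'rV[R]_N,
        (forall x, hyperbolic_space x -> uniform_on_Sigma x (xi i) (K x)) /\
        forall (F : set Omega) (B : set 'rV[R]_N),
          past (widen_ord (leqnSn M) i) F -> measurable B ->
          P (F `&` u (lift ord0 i) @^-1` B) =
          (\int[P]_(omega in F) K (u (widen_ord (leqnSn M) i) omega) B)%E].

End hyperbolic_walk.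

(* Extended-real valued: +oo when the variance is infinite. *)
Definition std_deviation {d : measure_display} {Omega : measurableType d}
    {R : realType} (P : probability Omega R) (X : Omega -> R) : \bar R :=
  sqrte (variance P X).

(* Main.v *)
Require Import Defs.
From HB Require Import structures.
From mathcomp Require Import all_boot all_order all_algebra.
From mathcomp Require Import all_classical all_reals all_analysis.
From mathcomp Require Import measurable_realfun giry ring.

Set Implicit Arguments.
Unset Strict Implicit.
Unset Printing Implicit Defensive.

Import Order.TTheory GRing.Theory Num.Theory.
Import numFieldNormedType.Exports.

Local Open Scope classical_set_scope.
Local Open Scope ring_scope.

(** Write N = n + 1, let z_k = <u_k, u_0>, and let w be uniform on the unit
    sphere of the n-dimensional Euclidean space u^perp. The symmetries of that
    sphere give E[<w, v>] = 0 and E[<w, v>^2] = (<v, u>^2 - <v, v>) / n, where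
    <v, u>^2 - <v, v> is the squared Euclidean length of the projection of v to
    u^perp. Both facts are contained in the formula of
    [integral_tangent_sphere],
      E[(a + <w, v>)^2] = a^2 + (<v, u>^2 - <v, v>) / n    for all real a.
    As u_(k+1) = cosh xi_k u_k + sinh xi_k w, it follows, conditioning on u_k,
    that for every real c
      E[(z_(k+1) + c)^2]
        = E[(cosh xi_k z_k + c)^2 + sinh^2 xi_k (z_k^2 - 1) / n]
    ([walk_step]). Working with the squares (z + c)^2 for all c, instead of z
    and z^2, keeps all integrands nonnegative until the moments are known to be
    finite; the first two moments are recovered from the dependence on c
    ([integral_quadratic]).

    The recursion is linear in the moments. It gives E[z_k] = prod cosh xi_i,
    and, with b = N / (N - 1) and s_i = sinh^2 xi_i, it multiplies
    E[z_k^2] - 1/N by 1 + b s_k at each step, from the value 1 - 1/N = 1/b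
    at k = 0 ([walk_moments]). Hence
      sigma^2 = prod (1 + b s_i) / b + (1 - 1/b) - prod (1 + s_i).
    Expanding both products over the subsets S of the steps gives the stated
    sum: the empty set cancels 1 - 1/b, and the singletons contribute 0
    ([sum_subsets]). The bound on sigma follows by replacing the exponents
    #S - 1 by M - 1 and summing over all S ([sum_subsets_le]). *)

(** * The Minkowski form *)

Section minkowski_form.
Context {R : realType} {n : nat}.
Implicit Types (x y z a u v w : 'rV[R]_n.+1) (c : R).

Local Notation form := (@minkowski_form R n.+1).

Lemma minkowski_formE x y : form x y =
  x ord0 ord0 * y ord0 ord0
  - \sum_(i < n) x ord0 (lift ord0 i) * y ord0 (lift ord0 i).
Proof. by rewrite /minkowski_form big_ord_recl/= -sumrN. Qed.

Lemma minkowski_formC x y : form x y = form y x.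
Proof.
by apply: eq_bigr => i _; rewrite mulrC.
Qed.

Lemma minkowski_formDl x y z : form (x + y) z = form x z + form y z.
Proof.
rewrite /minkowski_form -big_split; apply: eq_bigr => i _ /=.
by rewrite mxE; case: ifP => _; ring.
Qed.

Lemma minkowski_formZl c x y : form (c *: x) y = c * form x y.
Proof.
rewrite /minkowski_form mulr_sumr; apply: eq_bigr => i _ /=.
by rewrite mxE; case: ifP => _; ring.
Qed.

Lemma minkowski_formNl x y : form (- x) y = - form x y.
Proof. by rewrite -scaleN1r minkowski_formZl mulN1r. Qed.

Lemma minkowski_formDr x y z : form z (x + y) = form z x + form z y.
Proof. by rewrite minkowski_formC minkowski_formDl !(minkowski_formC z). Qed.

Lemma minkowski_formZr c x y : form y (c *: x) = c * form y x.
Proof. by rewrite minkowski_formC minkowski_formZl minkowski_formC. Qed.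

Lemma minkowski_formNr x y : form y (- x) = - form y x.
Proof. by rewrite minkowski_formC minkowski_formNl minkowski_formC. Qed.

Definition minkowski_form_lin := (minkowski_formDl, minkowski_formNl,
  minkowski_formZl, minkowski_formDr, minkowski_formNr, minkowski_formZr).

Lemma minkowski_form_delta0 x : form x (delta_mx ord0 ord0) = x ord0 ord0.
Proof.
rewrite minkowski_formE mxE/= mulr1 big1 ?subr0// => i _.
by rewrite mxE/= mulr0.
Qed.

Lemma minkowski_form_deltaS x i :
  form x (delta_mx ord0 (lift ord0 i)) = - x ord0 (lift ord0 i).
Proof.
rewrite minkowski_formE mxE/= mulr0 sub0r (bigD1 i)//= mxE !eqxx mulr1.
rewrite big1 ?addr0// => j ji.
by rewrite mxE eqxx/= (inj_eq lift_inj) (negbTE ji) mulr0.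
Qed.

(** The reflection x |-> x - 2 <x, a> / <a, a> a, acting on row vectors from the
    right; the column in the product represents the linear form <., a>. *)
Definition reflection_mx a : 'M[R]_n.+1 :=
  1%:M - (2 / form a a) *:
    ((\col_i if val i == 0%N then a ord0 i else - a ord0 i) *m a).

Lemma mul_reflection_mx a x :
  x *m reflection_mx a = x - (2 / form a a * form x a) *: a.
Proof.
rewrite mulmxBr mulmx1 -scalemxAr mulmxA -scalerA; congr (_ - _ *: _).
rewrite (_ : x *m _ = (form x a)%:M) ?mul_scalar_mx//.
apply/matrixP => i j; rewrite !ord1 !mxE eqxx mulr1n.
by apply: eq_bigr => k _; rewrite mxE; case: ifP; rewrite ?mulrN.
Qed.

Lemma reflection_isometry a x y :
  form (x *m reflection_mx a) (y *m reflection_mx a) = form x y.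
Proof.
rewrite !mul_reflection_mx !minkowski_form_lin (minkowski_formC a y).
(* For isotropic a, division by 0 makes the matrix the identity. *)
have [->|a0] := eqVneq (form a a) 0; first by rewrite invr0; ring.
by field.
Qed.

(** An orthonormal basis f of u^perp, with the expansion of the form in the
    basis u, f. It is the image of the standard basis under the isometry tau
    that is minus the reflection along a = u + e0: this involution exchanges e0
    and u, and <a, a> = 2 (1 + u_0) is positive, so that u = e0 is covered too,
    unlike with the reflection along u - e0. *)
Lemma hyperbolic_frame u : hyperbolic_space u ->
  exists f : 'I_n -> 'rV[R]_n.+1,
    [/\ forall i j, form (f i) (f j) = - (i == j)%:R,
        forall i, form (f i) u = 0 &
        forall x y, form x y =
          form x u * form y u - \sum_i form x (f i) * form y (f i)].
Proof.
move=> [uu /(_ ord0 erefl) u0].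
pose e0 : 'rV[R]_n.+1 := delta_mx ord0 ord0.
(* The equation aE is kept apart so that linearity does not split a. *)
have [a aE] : exists a, a = u + e0 by exists (u + e0).
have ue0 : form u e0 = u ord0 ord0 by rewrite minkowski_form_delta0.
have e00 : form e0 e0 = 1 by rewrite minkowski_form_delta0 mxE.
have k0 : 1 + u ord0 ord0 != 0 by rewrite gt_eqF// addr_gt0.
pose tau x := (form x a / (1 + u ord0 ord0)) *: a - x.
have tau_sym x y : form (tau x) y = form x (tau y).
  by rewrite !minkowski_form_lin (minkowski_formC a y); ring.
have aa : form a a = 2 * (1 + u ord0 ord0).
  by rewrite aE !minkowski_form_lin uu e00 (minkowski_formC e0 u) ue0; ring.
have tau_a x : form (tau x) a = form x a.
  by rewrite /tau !minkowski_form_lin aa; field.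
have tauK x : tau (tau x) = x.
  by rewrite {1}/tau tau_a /tau opprB addrCA subrr addr0.
have tau_e0 : tau e0 = u.
  rewrite /tau aE !minkowski_form_lin e00 (minkowski_formC e0 u) ue0.
  by rewrite [u _ _ + 1]addrC divff// scale1r addrK.
pose e i : 'rV[R]_n.+1 := delta_mx ord0 (lift ord0 i).
exists (fun i => tau (e i)); split=> [i j|i|x y].
- rewrite tau_sym tauK minkowski_form_deltaS mxE eqxx/=.
  by rewrite (inj_eq lift_inj) eq_sym.
- by rewrite -tau_e0 tau_sym tauK minkowski_form_delta0 mxE.
- transitivity (form (tau x) (tau y)); first by rewrite tau_sym tauK.
  rewrite -tau_e0 -!(tau_sym _ e0) !minkowski_form_delta0 minkowski_formE.
  congr (_ - _); apply: eq_bigr => i _.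
  by rewrite -!tau_sym !minkowski_form_deltaS mulrNN.
Qed.

End minkowski_form.

(** * Measurability on row vectors *)

Section measurability.
Context {R : realType} {N : nat} {d} {T : measurableType d}.

Lemma measurable_coord (i : 'I_N) :
  measurable_fun [set: 'rV[R]_N] (fun x => x ord0 i).
Proof.
move=> _ Y mY; rewrite setTI; apply: sub_sigma_algebra.
by rewrite (bigD1 i)//=; left; exists Y => //; rewrite setTI.
Qed.

Lemma measurable_fun_rV (f : T -> 'rV[R]_N) :
  (forall i, measurable_fun setT (fun t => f t ord0 i)) ->
  measurable_fun setT f.
Proof.
move=> mf.
apply: (measurability (\big[setU/set0]_(i < N) preimage_set_system setT
  (fun x : 'rV[R]_N => x ord0 i : measurableTypeR R) measurable)) => //.
move=> _ [B + <-]; rewrite -bigcup_seq => -[i _ [Y mY <-]]; rewrite !setTI.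
by rewrite -[X in measurable X]setTI; exact: mf.
Qed.

Lemma measurable_minkowski_form (f : T -> 'rV[R]_N) (g : T -> 'rV[R]_N) :
  measurable_fun setT f -> measurable_fun setT g ->
  measurable_fun setT (fun t => minkowski_form (f t) (g t)).
Proof.
move=> mf mg; apply: measurable_sum => i.
have mfi (h : T -> 'rV[R]_N) : measurable_fun setT h ->
    measurable_fun setT (fun t => h t ord0 i).
  by move=> mh; apply: (measurableT_comp (measurable_coord i)).
case: (val i == 0%N); first by apply: measurable_funM; exact: mfi.
by apply: measurableT_comp => //; apply: measurable_funM; exact: mfi.
Qed.

End measurability.

Lemma measurable_mulmxr {R : realType} {N : nat} (g : 'M[R]_N) :
  measurable_fun [set: 'rV[R]_N] (fun w => w *m g).
Proof.
apply: measurable_fun_rV => i; under eq_fun do rewrite mxE.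
apply: measurable_sum => j; apply: measurable_funM => //.
exact: measurable_coord.
Qed.

(** * Moments of the uniform distribution on the unit sphere of u^perp *)

Lemma measurable_tangent_sphere {R : realType} {N : nat} (u : 'rV[R]_N) :
  measurable (tangent_sphere u).
Proof.
rewrite (_ : tangent_sphere u =
  (fun w => minkowski_form w u) @^-1` [set 0] `&`
  (fun w => minkowski_form w w) @^-1` [set -1]); last by apply/seteqP; split.
by apply: measurableI; rewrite -[X in measurable X]setTI;
  apply: measurable_minkowski_form => //; exact: measurable_id.
Qed.

Section rotation_invariant.
Context {R : realType} {n : nat} {u : 'rV[R]_n.+1}.
Context {nu : probability 'rV[R]_n.+1 R}.
Hypothesis nu_inv : rotation_invariant u nu.

Local Notation form := (@minkowski_form R n.+1).

Lemma ae_tangent_sphere : {ae nu, forall w, tangent_sphere u w}.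
Proof.
have mS := measurable_tangent_sphere u.
exists (~` tangent_sphere u); split => //; first exact: measurableC.
by rewrite probability_setC// nu_inv.1 subee.
Qed.

Lemma integral_isometry (g : 'M[R]_n.+1) (h : 'rV[R]_n.+1 -> \bar R) :
  (forall x y, form (x *m g) (y *m g) = form x y) -> u *m g = u ->
  measurable_fun setT h -> (forall w, 0 <= h w)%E ->
  (\int[nu]_w h (w *m g) = \int[nu]_w h w)%E.
Proof.
move=> gI gu mh h0.
have mg := measurable_mulmxr g.
rewrite -[LHS](ge0_integral_pushforward mg nu measurableT)//.
by apply: eq_measure_integral => A mA _; exact: nu_inv.2.
Qed.

Section frame.
Variable f : 'I_n -> 'rV[R]_n.+1.
Hypothesis ff : forall i j, form (f i) (f j) = - (i == j)%:R.
Hypothesis fu : forall i, form (f i) u = 0.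
Hypothesis f_decomp : forall x y, form x y =
  form x u * form y u - \sum_i form x (f i) * form y (f i).

Let mform v : measurable_fun setT (fun w => form w v).
Proof. by apply: measurable_minkowski_form => //; exact: measurable_id. Qed.

(** The reflection along f_j - f_i exchanges the two coordinates of w, so all
    the coordinates have the same second moment; the n squares sum to
    - <w, w> = 1. *)
Lemma integral_frame_sqr i : (0 < n)%N ->
  (\int[nu]_w (form w (f i) ^+ 2)%:E = (n%:R^-1)%:E)%E.
Proof.
move=> n0.
have mq j : measurable_fun setT (fun w => (form w (f j) ^+ 2)%:E).
  by apply/measurable_EFinP; exact: measurable_funX.
have q_ge0 j w : (0 <= (form w (f j) ^+ 2)%:E)%E by rewrite lee_fin sqr_ge0.
have q_eq j : (\int[nu]_w (form w (f j) ^+ 2)%:E =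
               \int[nu]_w (form w (f i) ^+ 2)%:E)%E.
  have [->//|ji] := eqVneq j i.
  rewrite -(integral_isometry (@reflection_isometry _ _ (f j - f i)) _
    (mq j))//.
    apply: eq_integral => w _; congr ((_ ^+ 2)%:E).
    rewrite mul_reflection_mx !minkowski_form_lin !ff !eqxx (negbTE ji).
    rewrite eq_sym (negbTE ji) /= mulr1n mulr0n.
    by field.
  rewrite mul_reflection_mx !minkowski_form_lin (minkowski_formC u) fu.
  by rewrite (minkowski_formC u) fu subrr mulr0 scale0r subr0.
have : (\sum_(j < n) \int[nu]_w (form w (f j) ^+ 2)%:E = 1)%E.
  rewrite -ge0_integral_sum//.
  rewrite -(@probability_setT _ _ _ nu) -[nu setT]mul1e -integral_cst//.
  apply: ge0_ae_eq_integral => //.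
  - by apply: emeasurable_sum.
  - by move=> w _; apply: sume_ge0.
  - apply: filterS ae_tangent_sphere => w [wu ww] _.
    rewrite sumEFin; congr (_%:E).
    move: (f_decomp w w); rewrite ww wu mul0r sub0r => /oppr_inj ->.
    by apply: eq_bigr => j _; rewrite expr2.
rewrite (eq_bigr _ (fun j _ => q_eq j)) => /=.
have : (0 <= \int[nu]_w (form w (f i) ^+ 2)%:E)%E by exact: integral_ge0.
case: (integral _ _ _) => [r _|_|//].
  rewrite sumEFin sumr_const card_ord => -[rn]; congr (_%:E).
  rewrite -(mulr_natr r) in rn.
  by rewrite -[LHS](mulfK (x := n%:R)) ?rn ?mul1r// pnatr_eq0 -lt0n.
(* An infinite common value contradicts that the sum is 1. *)
case: n n0 => // m _.
rewrite big_ord_recl addye// gt_eqF// (lt_le_trans (ltNyr 0))//.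
by apply: sume_ge0 => j _; rewrite leey.
Qed.

(** Coordinates are added one at a time. The reflection along f_j changes the
    sign of t = b_j <w, f_j> and fixes the part S of the sum already treated,
    hence (S + t)^2 and (S - t)^2 have the same integral, which is therefore
    that of their mean S^2 + t^2. The
    cross term 2 S t is thus never integrated by itself. *)
Lemma integral_sqr_sum_frame (a : R) (b : 'I_n -> R) (s : seq 'I_n) :
  (0 < n)%N -> uniq s ->
  (\int[nu]_w ((a + \sum_(i <- s) b i * form w (f i)) ^+ 2)%:E =
   (a ^+ 2 + \sum_(i <- s) b i ^+ 2 / n%:R)%:E)%E.
Proof.
move=> n0; elim: s => [_|j s IH /= /andP[js us]].
  under eq_integral do rewrite big_nil addr0.
  rewrite integral_cst// big_nil addr0 -[RHS]mule1; congr (_ * _)%E.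
  exact: probability_setT.
pose S w := a + \sum_(i <- s) b i * form w (f i).
pose t w := b j * form w (f j).
have mS : measurable_fun setT S.
  apply: measurable_funD => //; apply: measurable_sum => i.
  exact: measurable_funM.
have mt : measurable_fun setT t by exact: measurable_funM.
have msqr (h : 'rV[R]_n.+1 -> R) : measurable_fun setT h ->
    measurable_fun setT (fun w => (h w ^+ 2)%:E).
  by move=> mh; apply/measurable_EFinP; exact: measurable_funX.
have flip :
    (\int[nu]_w ((S w - t w) ^+ 2)%:E = \int[nu]_w ((S w + t w) ^+ 2)%:E)%E.
  rewrite -(integral_isometry (@reflection_isometry _ _ (f j)) _
    (h := fun w => ((S w + t w) ^+ 2)%:E)).
  - apply: eq_integral => w _; congr ((_ ^+ 2)%:E).
    rewrite /S /t !mul_reflection_mx !minkowski_form_lin !ff eqxx.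
    congr (_ + _ + _); last by rewrite mulr1n; field.
    apply: eq_big_seq => i si; rewrite !minkowski_form_lin !ff.
    have /negbTE -> : j != i by apply: contraNneq js => ->.
    by rewrite oppr0 mulr0 oppr0 addr0.
  - by rewrite mul_reflection_mx (minkowski_formC u) fu mulr0 scale0r subr0.
  - by apply: msqr; exact: measurable_funD.
  - by move=> w; rewrite lee_fin sqr_ge0.
have -> : (\int[nu]_w ((a + \sum_(i <- j :: s) b i * form w (f i)) ^+ 2)%:E =
   \int[nu]_w ((S w + t w) ^+ 2)%:E)%E.
  by apply: eq_integral => w _; rewrite big_cons /S /t [_ * _ + _]addrC addrA.
transitivity (\int[nu]_w (S w ^+ 2)%:E + \int[nu]_w (t w ^+ 2)%:E)%E;
  last first.
  rewrite IH//.
  under [X in (_ + X)%E]eq_integral do rewrite exprMn EFinM.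
  rewrite ge0_integralZl_EFin ?sqr_ge0//; last 2 first.
  - by move=> w _; rewrite lee_fin sqr_ge0.
  - exact: msqr.
  rewrite integral_frame_sqr// -EFinM -EFinD big_cons; congr (_%:E).
  by ring.
have mS2 := msqr _ mS; have mt2 := msqr _ mt.
rewrite -ge0_integralD//; [|by move=> w _; rewrite lee_fin sqr_ge0..].
rewrite [RHS](eq_integral (fun w =>
    2^-1%:E * ((S w + t w) ^+ 2)%:E + 2^-1%:E * ((S w - t w) ^+ 2)%:E)%E).
  2: by move=> w _; rewrite -!EFinM -!EFinD; congr (_%:E); field.
have mD : measurable_fun setT (fun w => ((S w + t w) ^+ 2)%:E).
  by apply: msqr; exact: measurable_funD.
have mB : measurable_fun setT (fun w => ((S w - t w) ^+ 2)%:E).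
  by apply: msqr; exact: measurable_funB.
rewrite ge0_integralD//=; last 4 first.
- by move=> w _; rewrite mule_ge0// lee_fin ?sqr_ge0.
- exact: measurable_funeM.
- by move=> w _; rewrite mule_ge0// lee_fin ?sqr_ge0.
- exact: measurable_funeM.
rewrite !ge0_integralZl_EFin//; [|by move=> w _; rewrite lee_fin sqr_ge0..].
rewrite flip -ge0_muleDl ?lee_fin//.
by rewrite -EFinD (_ : _ + _ = 1) ?mul1e//; field.
Qed.

End frame.

Lemma integral_tangent_sphere (a : R) (v : 'rV[R]_n.+1) :
  (0 < n)%N -> hyperbolic_space u ->
  (\int[nu]_w ((a + form w v) ^+ 2)%:E =
   (a ^+ 2 + (form v u ^+ 2 - form v v) / n%:R)%:E)%E.
Proof.
move=> n0 /hyperbolic_frame[f [ff fu fd]].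
transitivity
  (\int[nu]_w ((a + \sum_i (- form v (f i)) * form w (f i)) ^+ 2)%:E)%E.
  have mform x : measurable_fun setT (fun w => form w x).
    by apply: measurable_minkowski_form => //; exact: measurable_id.
  apply: ge0_ae_eq_integral => //.
  - apply/measurable_EFinP/measurable_funX; exact: measurable_funD.
  - apply/measurable_EFinP/measurable_funX; apply: measurable_funD => //.
    by apply: measurable_sum => i; exact: measurable_funM.
  - by move=> w _; rewrite lee_fin sqr_ge0.
  - by move=> w _; rewrite lee_fin sqr_ge0.
  - apply: filterS ae_tangent_sphere => w [wu _] _.
    congr ((_ ^+ 2)%:E); rewrite fd wu mul0r sub0r -sumrN; congr (_ + _).
    by apply: eq_bigr => i _; rewrite mulNr mulrC.
rewrite (integral_sqr_sum_frame ff fu fd)// ?index_enum_uniq//.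
congr (_ + _)%:E; rewrite -mulr_suml; congr (_ / _).
rewrite (fd v v) expr2 opprB addrCA subrr addr0.
by apply: eq_bigr => i _; rewrite sqrrN expr2.
Qed.

End rotation_invariant.

(** * One step of the walk *)

Lemma integral_uniform_on_Sigma {R : realType} {n : nat} (u v : 'rV[R]_n.+1)
    (xi c : R) (mu : {measure set 'rV[R]_n.+1 -> \bar R}) :
  (0 < n)%N -> hyperbolic_space u -> uniform_on_Sigma u xi mu ->
  (\int[mu]_x ((minkowski_form x v + c) ^+ 2)%:E =
   ((cosh xi * minkowski_form u v + c) ^+ 2 +
    sinh xi ^+ 2 * (minkowski_form u v ^+ 2 - minkowski_form v v) / n%:R)%:E)%E.
Proof.
move=> n0 uH [nu [nu_inv muE]].
pose phi w := cosh xi *: u + sinh xi *: w.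
have mphi : measurable_fun [set: 'rV[R]_n.+1] phi.
  apply: measurable_fun_rV => i; under eq_fun do rewrite !mxE.
  apply: measurable_funD => //; apply: measurable_funM => //.
  exact: measurable_coord.
have mh : measurable_fun [set: 'rV[R]_n.+1]
    (fun x => ((minkowski_form x v + c) ^+ 2)%:E).
  apply/measurable_EFinP/measurable_funX/measurable_funD => //.
  by apply: measurable_minkowski_form => //; exact: measurable_id.
transitivity (\int[pushforward nu phi]_x ((minkowski_form x v + c) ^+ 2)%:E)%E.
  by apply: eq_measure_integral => A mA _; exact: muE.
rewrite (ge0_integral_pushforward mphi nu measurableT)//; last first.
  by move=> x _; rewrite lee_fin sqr_ge0.
rewrite preimage_setT.
transitivity (\int[nu]_w ((cosh xi * minkowski_form u v + c +
    minkowski_form w (sinh xi *: v)) ^+ 2)%:E)%E.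
  apply: eq_integral => w _ /=; congr ((_ ^+ 2)%:E).
  by rewrite /phi !minkowski_form_lin; ring.
rewrite (integral_tangent_sphere nu_inv)// !minkowski_form_lin.
by rewrite (minkowski_formC v u); congr (_%:E); ring.
Qed.

Section kernel_giry.
Context {d1 d2} {T1 : measurableType d1} {T2 : measurableType d2}.
Context {R : realType}.
Variables (K : R.-pker T1 ~> T2) (x : T1).

(** The values of a probability kernel, packaged as elements of the Giry monad:
    integration against the law of Y is then integration against a monadic
    bind. *)
Definition kernel_giry : set T2 -> \bar R := K x.

Let kernel_giry0 : kernel_giry set0 = 0%E. Proof. exact: measure0. Qed.

Let kernel_giry_ge0 A : (0 <= kernel_giry A)%E. Proof. exact: measure_ge0. Qed.

Let kernel_giry_sigma_additive : semi_sigma_additive kernel_giry.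
Proof. exact: measure_semi_sigma_additive. Qed.

HB.instance Definition _ := isMeasure.Build _ _ _ kernel_giry
  kernel_giry0 kernel_giry_ge0 kernel_giry_sigma_additive.

Let kernel_giry_setT : (kernel_giry setT <= 1)%E.
Proof. exact: sprob_kernel_le1. Qed.

HB.instance Definition _ :=
  Measure_isSubProbability.Build _ _ _ kernel_giry kernel_giry_setT.

End kernel_giry.

(** Since the law of Y is the bind of P with omega |-> K (X omega), this is
    associativity of integration in the Giry monad. *)
Lemma integral_kernel {d d1 d2} {Omega : measurableType d}
    {T1 : measurableType d1} {T2 : measurableType d2} {R : realType}
    (P : probability Omega R) (X : Omega -> T1) (Y : Omega -> T2)
    (K : R.-pker T1 ~> T2) (h : T2 -> \bar R) :
  measurable_fun setT X -> measurable_fun setT Y ->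
  (forall B, measurable B ->
     P (Y @^-1` B) = \int[P]_omega K (X omega) B)%E ->
  measurable_fun setT h -> (forall y, 0 <= h y)%E ->
  (\int[P]_omega h (Y omega) = \int[P]_omega \int[K (X omega)]_y h y)%E.
Proof.
move=> mX mY XY mh h0.
pose KX omega : giry T2 R := kernel_giry K (X omega).
have mKX : measurable_fun setT KX.
  apply: measurable_giry_codensity => // B mB.
  exact: measurableT_comp (measurable_kernel K B mB) mX.
transitivity (\int[pushforward P Y]_y h y)%E.
  by rewrite (ge0_integral_pushforward mY P measurableT).
transitivity (\int[giry_bind (P : giry Omega R) mKX]_y h y)%E.
  apply: eq_measure_integral => B mB _.
  rewrite [LHS]XY// /giry_bind/= /giry_join/=.
  rewrite giry_int_map//; exact: measurable_giry_ev.
exact: giry_int_bind.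
Qed.

(** * Moments of the walk *)

Lemma sqr_cosh {R : realType} (t : R) : cosh t ^+ 2 = 1 + sinh t ^+ 2.
Proof.
have := expRxMexpNx_1 t; rewrite /cosh /sinh.
move: (expR t) (expR (- t)) => a b ab.
by transitivity (a * b + ((a - b) / 2) ^+ 2); [field|rewrite ab].
Qed.

(** A quadratic polynomial in Z is a combination of Z^2, (Z + 1)^2 and a
    constant, which are integrable because the squares have finite
    integral. *)
Lemma integral_quadratic {d} {Omega : measurableType d} {R : realType}
    (P : probability Omega R) (Z : Omega -> R) (A B : R) :
  measurable_fun setT Z ->
  (forall c, \int[P]_omega ((Z omega + c) ^+ 2)%:E =
             (A + 2 * c * B + c ^+ 2)%:E)%E ->
  forall p q r, (\int[P]_omega (p * Z omega ^+ 2 + q * Z omega + r)%:E =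
    (p * A + q * B + r)%:E)%E.
Proof.
move=> mZ ZE p q r.
have iZ c : P.-integrable setT (EFin \o (fun omega => (Z omega + c) ^+ 2)).
  apply/integrableP; split.
    by apply/measurable_EFinP/measurable_funX; exact: measurable_funD.
  rewrite (eq_integral (fun omega => ((Z omega + c) ^+ 2)%:E)) ?ZE ?ltry//.
  by move=> omega _; rewrite /= ger0_norm// sqr_ge0.
rewrite (eq_integral (fun omega =>
    (((p - q / 2)%:E * ((Z omega + 0) ^+ 2)%:E +
      (q / 2)%:E * ((Z omega + 1) ^+ 2)%:E) + (r - q / 2)%:E))%E); last first.
  by move=> omega _; rewrite -!EFinM -!EFinD; congr (_%:E); field.
rewrite integralD//=; last 2 first.
- by apply: integrableD => //; apply: integrableZl => //; exact: iZ.
- exact: finite_measure_integrable_cst.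
rewrite integralD//=; last 2 first.
- by apply: integrableZl => //; exact: iZ.
- by apply: integrableZl => //; exact: iZ.
rewrite integralZl//=; last exact: iZ.
rewrite integralZl//=; last exact: iZ.
rewrite integral_cst//= probability_setT mule1 !ZE -!EFinM -!EFinD.
by congr (_%:E); field.
Qed.

Section walk.
Context {d} {Omega : measurableType d} {R : realType}.
Variables (P : probability Omega R) (n M : nat) (n_gt0 : (0 < n)%N).
Variables (xi : 'I_M -> R) (u0 : 'rV[R]_n.+1) (hu0 : hyperbolic_space u0).
Variables (u : 'I_M.+1 -> {RV P >-> 'rV[R]_n.+1}).
Hypothesis hu : hyperbolic_walk xi u0 u.

Let b : R := n.+1%:R / n%:R.

Let n0 : n%:R != 0 :> R. Proof. by rewrite pnatr_eq0 -lt0n. Qed.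
Let n1 : n%:R + 1 != 0 :> R. Proof. by rewrite natr1 pnatr_eq0. Qed.

(** Taking the whole space as the event of the past, the law of the next point
    is the mixture of the laws K(u_i) over the law of u_i; the inner integral is
    then an integral over a sphere. *)
Lemma walk_step (i : 'I_M) (c : R) :
  let z k omega := minkowski_form (u k omega) u0 in
  let i' := widen_ord (leqnSn M) i in
  (\int[P]_omega ((z (lift ord0 i) omega + c) ^+ 2)%:E =
   \int[P]_omega ((cosh (xi i) * z i' omega + c) ^+ 2
     + sinh (xi i) ^+ 2 * (z i' omega ^+ 2 - 1) / n%:R)%:E)%E.
Proof.
move=> z i'; have [uH _ /(_ i)[K [KH KE]]] := hu.
have mh : measurable_fun [set: 'rV[R]_n.+1]
    (fun x => ((minkowski_form x u0 + c) ^+ 2)%:E).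
  apply/measurable_EFinP/measurable_funX/measurable_funD => //.
  by apply: measurable_minkowski_form => //; exact: measurable_id.
rewrite (integral_kernel (X := u i') (K := K) _ _ _ mh)//; last 2 first.
- move=> B mB; rewrite -[X in P X]setTI; apply: KE => //.
  by rewrite -setC0; apply: sigma_algebraC; exact: sigma_algebra0.
- by move=> x; rewrite lee_fin sqr_ge0.
apply: eq_integral => omega _.
rewrite (integral_uniform_on_Sigma _ _ n_gt0 (uH _ _) (KH _ (uH _ _))).
by rewrite hu0.1.
Qed.

(** Reading the right-hand side as E[z^2] + 2 c E[z] + c^2, the second moment is
    prod (1 + b s_i) / b + (1 - 1/b), where 1 - 1/b = 1/N is the fixed point of
    the recursion A |-> (1 + s) A + s (A - 1) / n, with s_i = sinh^2 xi_i. *)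
Lemma walk_moments (k : 'I_M.+1) (c : R) :
  (\int[P]_omega ((minkowski_form (u k omega) u0 + c) ^+ 2)%:E =
   (b^-1 * (\prod_(i < M | (i < k)%N) (1 + b * sinh (xi i) ^+ 2)) + (1 - b^-1)
    + 2 * c * (\prod_(i < M | (i < k)%N) cosh (xi i)) + c ^+ 2)%:E)%E.
Proof.
case: k => k kM; elim: k kM c => [|k IH] kM c.
  rewrite !big_pred0_eq.
  have u0E omega : u (Ordinal kM) omega = u0.
    by have [_ /(_ omega) <- _] := hu; congr (u _ _); exact/val_inj.
  under eq_integral do rewrite u0E hu0.1.
  by rewrite integral_cst//= probability_setT mule1; congr (_%:E); ring.
pose i : 'I_M := Ordinal (kM : k < M)%N.
rewrite /=; have -> : Ordinal kM = lift ord0 i by exact/val_inj.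
have k'M : (k < M.+1)%N by exact: ltnW.
rewrite walk_step.
have -> : widen_ord (leqnSn M) i = Ordinal k'M by exact/val_inj.
have prodS (F : 'I_M -> R) : \prod_(j < M | (j < k.+1)%N) F j =
    F i * \prod_(j < M | (j < k)%N) F j.
  rewrite (bigD1 i)//=; congr (_ * _); apply: eq_bigl => j.
  rewrite ltnS leq_eqVlt -(inj_eq val_inj)/=.
  by case: eqP => [->|]; rewrite ?ltnn ?andbT.
rewrite !prodS.
set Q := \prod_(j < M | (j < k)%N) (1 + _).
set B := \prod_(j < M | (j < k)%N) cosh _.
have {}IH e := IH k'M e; rewrite /= -/Q -/B in IH.
set S := sinh (xi i) ^+ 2.
rewrite (eq_integral (fun omega =>
  ((cosh (xi i) ^+ 2 + S / n%:R) *
     minkowski_form (u (Ordinal k'M) omega) u0 ^+ 2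
  + (2 * c * cosh (xi i)) * minkowski_form (u (Ordinal k'M) omega) u0
  + (c ^+ 2 - S / n%:R))%:E)); last first.
  by move=> omega _; congr (_%:E); ring.
rewrite (integral_quadratic _ IH); last first.
  by apply: measurable_minkowski_form => //; exact: measurable_cst.
congr (_%:E); rewrite sqr_cosh -/S /b -natr1.
field.
by rewrite n0 n1.
Qed.

End walk.

(** * Expansion over the subsets of the steps *)

Lemma prod_1D {R : comRingType} {I : finType} (x : I -> R) :
  \prod_i (1 + x i) = \sum_(S : {set I}) \prod_(i in S) x i.
Proof.
under eq_bigr do rewrite addrC.
rewrite bigA_distr; apply: eq_bigr => S _.
by rewrite [RHS]big_mkcond.
Qed.

Lemma sum_subsets {R : fieldType} {I : finType} (b : R) (x : I -> R) : b != 0 ->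
  b^-1 * (\prod_i (1 + b * x i)) + (1 - b^-1) - \prod_i (1 + x i) =
  \sum_(S : {set I} | (2 <= #|S|)%N) (b ^+ (#|S| - 1) - 1) * \prod_(i in S) x i.
Proof.
move=> b0.
rewrite !prod_1D mulr_sumr addrAC -sumrB (bigD1 finset.set0)//= !big_set0.
rewrite mulr1 addrAC -[1 - b^-1]opprB subrr add0r.
rewrite big_mkcond [RHS]big_mkcond; apply: eq_bigr => S _.
rewrite big_split/= prodr_const -cards_eq0.
case: #|S| => [|[|m]]//=.
  by rewrite expr1 mulKf// subrr.
by rewrite subSS subn0 exprS mulrA mulKf// mulrBl mul1r.
Qed.

Lemma sum_subsets_le {R : realFieldType} {I : finType} (b : R) (x : I -> R) :
  1 <= b -> (forall i, 0 <= x i) ->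
  \sum_(S : {set I} | (2 <= #|S|)%N) (b ^+ (#|S| - 1) - 1) * \prod_(i in S) x i
  <= (b ^+ (#|I| - 1) - 1) * \prod_i (1 + x i).
Proof.
move=> b1 x0; rewrite prod_1D mulr_sumr [leLHS]big_mkcond.
apply: ler_sum => S _; have px : 0 <= \prod_(i in S) x i by apply: prodr_ge0.
case: ifP => _.
  apply: ler_wpM2r => //; rewrite lerB// ler_weXn2l//.
  by apply: leq_sub2r; exact: max_card.
by rewrite mulr_ge0// subr_ge0 exprn_ege1.
Qed.

(** * Mean and standard deviation *)

Theorem mainTheorem2 (R : realType) (d : measure_display)
    (Omega : measurableType d) (P : probability Omega R)
    (N M : nat) (hN : (2 <= N)%N) (hM : (1 <= M)%N)
    (xi : 'I_M -> R) (hxi : forall i, 0 <= xi i)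
    (u0 : 'rV[R]_N) (hu0 : hyperbolic_space u0)
    (u : 'I_M.+1 -> {RV P >-> 'rV[R]_N})
    (hu : hyperbolic_walk xi u0 u) :
  let X := fun omega : Omega => minkowski_form (u ord_max omega) u0 in
  let sigma := std_deviation P X in
  [/\ expectation P X = (\prod_(i < M) cosh (xi i))%:E,
      (sigma ^+ 2)%E =
        (\sum_(S : {set 'I_M} | (2 <= #|S|)%N)
           ((N%:R / (N%:R - 1)) ^+ (#|S| - 1) - 1)
             * \prod_(i in S) sinh (xi i) ^+ 2)%:E &
      (sigma <= (Num.sqrt ((N%:R / (N%:R - 1)) ^+ (M - 1) - 1)
                   * \prod_(i < M) cosh (xi i))%:E)%E].
Proof.
move=> X sigma.
case: N hN u0 hu0 u hu @X @sigma => [//|n] n0 u0 hu0 u hu X sigma.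
rewrite -[n.+1%:R - 1]/(n.+1%:R - 1%:R) -natrB// subSS subn0.
set b := n.+1%:R / n%:R.
have n_gt0 : 0 < n%:R :> R by rewrite ltr0n.
have b1 : 1 <= b by rewrite ler_pdivlMr// mul1r ler_nat.
have b0 : b != 0 by rewrite gt_eqF// (lt_le_trans ltr01).
have mX : measurable_fun setT X.
  by apply: measurable_minkowski_form => //; exact: measurable_cst.
have := walk_moments n0 hu0 hu ord_max; rewrite -/b.
rewrite !(eq_bigl _ _ (fun i => ltn_ord i)).
set A := _ + (1 - _); set B := \prod_i cosh _ => XE.
have EX : expectation P X = B%:E.
  rewrite unlock (eq_integral (fun omega =>
    (0 * X omega ^+ 2 + 1 * X omega + 0)%:E)).
    by rewrite (integral_quadratic mX XE); congr (_%:E); ring.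
  by move=> omega _; congr (_%:E); ring.
have B2 : B ^+ 2 = \prod_(i < M) (1 + sinh (xi i) ^+ 2).
  by rewrite -prodrXl; apply: eq_bigr => i _; rewrite sqr_cosh.
set V := \sum_(S | _) _.
have VX : variance P X = V%:E.
  rewrite /variance unlock EX unlock.
  rewrite (eq_integral (fun omega => ((X omega + (- B)) ^+ 2)%:E))//.
  rewrite XE /V -sum_subsets// -B2 -/A; congr (_%:E); ring.
have V0 : 0 <= V by rewrite -lee_fin -VX variance_ge0.
split=> //.
  by rewrite /sigma /std_deviation sqr_sqrte VX ?lee_fin.
rewrite /sigma /std_deviation VX lee_fin.
have B0 : 0 <= B.
  apply: prodr_ge0 => i _.
  by rewrite divr_ge0// addr_ge0// expR_ge0.
have bM : 0 <= b ^+ (M - 1) - 1 by rewrite subr_ge0 exprn_ege1.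
rewrite -[B]ger0_norm// -sqrtr_sqr -sqrtrM// ler_wsqrtr// B2.
have := sum_subsets_le b1 (fun i => sqr_ge0 (sinh (xi i))).
by rewrite card_ord.
Qed.
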